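(* Let $\alpha : I \to [0,1]$, $t \mapsto \alpha_t$, and $\alpha' : I' \to [0,1]$, $s \mapsto \alpha'_s$, be two monotonically (strictly) decreasing noise schedules (the prime is part of the name and does not denote a derivative), and let $r_m$ and $r'_m$ ($m = 0, 1, \dots, M-1$) be their respective resolution chromatographies. Suppose there exists a mapping $t' : I \to I'$, $t \mapsto t'(t)$, such that $\alpha_t = \alpha'_{t'(t)}$ for all $t \in I$. Then for all $m \in \{0, 1, \dots, M-1\}$, $$ r_m(t) = r'_m\big(t'(t)\big) $$ for every $t \in I$ with $0 < \alpha_t < 1$ at which both sides are defined.
   Context: Noise schedule: a function $t \mapsto \alpha_t \in [0,1]$ on a time interval $I$ of the form $[0,T]$ or $[0,\infty)$ (the interval may differ from schedule to schedule), with $\alpha_0 = 1$, continuous on $I$ and differentiable at interior times, and strictly decreasing. Signal-to-noise ratio: $\mathrm{SNR}(t) = \dfrac{\alpha_t}{1-\alpha_t}$ for times $t$ with $0<\alpha_t<1$. It is strictly decreasing in $t$, hence invertible onto its range; its inverse is denoted $\mathrm{SNR}^{-1}$. Adjusted time: for a resolution level $m \in \{0,1,\dots,M-1\}$, where $M \ge 1$ is a fixed number of resolution levels (the same for both schedules), and a time $t$ with $0<\alpha_t<1$, $$ \tau_m = \tau_m(t) = \mathrm{SNR}^{-1}\big(2^{2m}\,\mathrm{SNR}(t)\big). $$ In particular $\tau_0 = t$. Resolution chromatography of the schedule $\alpha$: for $m \in \{0,\dots,M-1\}$, $$ r_m(t) = \frac{1}{Z(t)}\,\frac{d}{dt}\,\alpha_{\tau_m(t)},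 \qquad Z(t) = \sum_{n=0}^{M-1} \frac{d}{dt}\,\alpha_{\tau_n(t)}, $$ defined at interior times $t$ with $0<\alpha_t<1$ and $Z(t) \neq 0$. Here $\frac{d}{dt}\alpha_{\tau_m(t)}$ is the derivative of the composite function $t \mapsto \alpha_{\tau_m(t)}$. For the schedule $\alpha'$, the quantities $\mathrm{SNR}'$, $\tau'_m$, $Z'$ and $r'_m$ are defined by the same formulas with $\alpha$ replaced by $\alpha'$, with its own time variable $s \in I'$ in place of $t$. *)

(* Defs.v *)
From HB Require Import structures.
From mathcomp Require Import all_boot all_order all_algebra.
From mathcomp Require Import all_classical all_reals all_analysis.
Set Implicit Arguments.
Unset Strict Implicit.
Unset Printing Implicit Defensive.
Import Order.TTheory GRing.Theory Num.Theory.
Import numFieldNormedType.Exports.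
Local Open Scope classical_set_scope.
Local Open Scope ring_scope.

Definition time_interval (R : realType) (I : set R) : Prop :=
  (exists2 T : R, 0 < T & I = `[0, T]%classic) \/ I = `[0, +oo[%classic.

(* A schedule is a total function of which only the values on I matter. *)
Record noise_schedule (R : realType) (I : set R) (alpha : R -> R) : Prop := {
  schedule_interval : time_interval I;
  schedule_range : forall t, I t -> 0 <= alpha t <= 1;
  schedule_init : alpha 0 = 1;
  schedule_continuous : {within I, continuous alpha};
  schedule_derivable : forall t, I° t -> derivable alpha t 1;
  schedule_decreasing : forall s t, I s -> I t -> s < t -> alpha t < alpha s
}.

Definition SNR_dom (R : realType) (I : set R) (alpha : R -> R) : set R :=
  [set t | I t /\ 0 < alpha t < 1].

Definition SNR (R : realType) (alpha : R -> R) (t : R) : R :=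
  alpha t / (1 - alpha t).

(* The inverse of SNR restricted to SNR_dom, where it is injective; outside
   the range of that restriction the value is arbitrary. *)
Definition SNR_inv (R : realType) (I : set R) (alpha : R -> R) : R -> R :=
  'pinv_(fun=> 0) (SNR_dom I alpha) (SNR alpha).

Definition adjusted_time (R : realType) (I : set R) (alpha : R -> R)
    (m : nat) (t : R) : R :=
  SNR_inv I alpha (2 ^+ (2 * m) * SNR alpha t).

(* The derivative of the composite function t |-> alpha (tau_m t). It exists
   at every interior t with 0 < alpha t < 1: by continuity, alpha takes all
   values in [alpha t, 1], so 2 ^ (2 m) SNR(t) is in the range of SNR. *)
Definition level_rate (R : realType) (I : set R) (alpha : R -> R)
    (m : nat) (t : R) : R :=
  derive1 (alpha \o adjusted_time I alpha m) t.

Definition normalization (R : realType) (I : set R) (alpha : R -> R)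
    (M : nat) (t : R) : R :=
  \sum_(n < M) level_rate I alpha n t.

Definition chromatography (R : realType) (I : set R) (alpha : R -> R)
    (M : nat) (m : 'I_M) (t : R) : R :=
  (normalization I alpha M t)^-1 * level_rate I alpha m t.

Definition chromatography_defined (R : realType) (I : set R) (alpha : R -> R)
    (M : nat) (t : R) : Prop :=
  [/\ I° t, 0 < alpha t < 1 & normalization I alpha M t != 0].

(* Main.v *)
(** The value [alpha (tau_m t)] depends on [t] only through [a = alpha t]: it is
    [k a / (1 - a + k a)] with [k = 2 ^ (2 m)]. By the chain rule, every level
    rate is a function of [m] and [a] times the common factor [d alpha / dt], which
    cancels in the chromatography; hence the latter is a function of [alpha t]
    alone. *)

Require Import Defs.
From HB Require Import structures.
From mathcomp Require Import all_boot all_order all_algebra.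
From mathcomp Require Import all_classical all_reals all_analysis.
From mathcomp Require Import ring lra.
Import Order.TTheory GRing.Theory Num.Theory.
Import numFieldNormedType.Exports.
Local Open Scope classical_set_scope.
Local Open Scope ring_scope.

(** As [SNR] is the odds of [alpha], this is the value whose odds [b / (1 - b)] are [k] times those
    of [a], for [a] in []0, 1[]. *)
Definition odds_scale {R : realType} (k a : R) : R := k * a / (1 - a + k * a).

Lemma odds_scale_itv {R : realType} {k a : R} :
  1 <= k -> 0 < a < 1 -> a <= odds_scale k a < 1.
Proof.
move=> k1 /andP[a0 a1]; have d0 : 0 < 1 - a + k * a by nra.
(* The product is the numerator of [odds_scale k a - a] over the denominator [1 - a + k * a]. *)
have : 0 <= (k - 1) * (a * (1 - a)) by rewrite !mulr_ge0; lra.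
by rewrite /odds_scale ler_pdivlMr// ltr_pdivrMr// => h; apply/andP; split; nra.
Qed.

Lemma odds_scaleP {R : realType} {k a b : R} :
  1 <= k -> 0 < a < 1 -> 0 < b < 1 ->
  b / (1 - b) = k * (a / (1 - a)) <-> b = odds_scale k a.
Proof.
move=> k1 /andP[a0 a1] /andP[b0 b1].
have d0 : 0 < 1 - a + k * a by nra.
have a'0 : 1 - a != 0 by lra.
have b'0 : 1 - b != 0 by lra.
have d'0 : 1 - a + k * a != 0 by lra.
rewrite /odds_scale mulrA; split=> /eqP.
  by rewrite eqr_div// => /eqP e; apply: (mulIf d'0); rewrite divfK//; lra.
move=> /eqP e; apply/eqP; rewrite eqr_div//; apply/eqP.
have : b * (1 - a + k * a) = k * a by rewrite e divfK.
lra.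
Qed.

Lemma derivable_odds_scale {R : realType} {k a : R} :
  1 <= k -> 0 < a < 1 -> derivable (odds_scale k) a 1.
Proof.
move=> k1 /andP[a0 a1]; have d0 : 1 - a + k * a != 0 by nra.
by apply: derivableM => //; apply: derivableV.
Qed.

Lemma time_interval_itv0 {R : realType} {I : set R} {alpha : R -> R} {t : R} :
  noise_schedule I alpha -> I t -> 0 <= t /\ `[0, t] `<=` I.
Proof.
case/schedule_interval => [[T _ ->]|->] /=; rewrite in_itv/=.
  move=> /andP[t0 tT]; split=> // x /=; rewrite !in_itv/= => /andP[-> xt].
  exact: le_trans tT.
by rewrite andbT => t0; split=> // x /=; rewrite !in_itv/= andbT => /andP[].
Qed.

(** Since [alpha] falls continuously from 1 at time 0, it takes the scaled value on [[0, t]]. Hence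
    [k * SNR alpha t] is in the range of [SNR], where the pseudo-inverse is a true right inverse,
    and the resulting equation of odds is solved for [alpha]. *)
Lemma alpha_adjusted_time {R : realType} {I : set R} {alpha : R -> R}
    (halpha : noise_schedule I alpha) (m : nat) {t : R} :
  SNR_dom I alpha t ->
  alpha (adjusted_time I alpha m t) = odds_scale (2 ^+ (2 * m)) (alpha t).
Proof.
set k : R := 2 ^+ (2 * m) => -[It at01].
have k1 : 1 <= k by apply: exprn_ege1; lra.
have /andP[ab b1] := odds_scale_itv k1 at01.
have b01 : 0 < odds_scale k (alpha t) < 1.
  by rewrite b1 andbT (lt_le_trans _ ab)//; case/andP: at01.
have [t0 tI] := time_interval_itv0 halpha It.
have [v vt vb] : exists2 v, v \in `[0, t] & alpha v = odds_scale k (alpha t).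
  apply: IVT => //.
    exact: continuous_subspaceW tI (schedule_continuous halpha).
  by rewrite (schedule_init halpha) ge_min le_max ab (ltW b1) orbT.
have im : (SNR alpha @` SNR_dom I alpha) (k * SNR alpha t).
  exists v; first by split; [exact: tI | rewrite vb].
  by apply/odds_scaleP; rewrite ?vb.
(* On the range the pseudo-inverse lands in [SNR_dom], not on its default value 0; so [odds_scaleP]
   applies at the adjusted time. *)
have [_ tau01] : SNR_dom I alpha (adjusted_time I alpha m t).
  have := @surjpinv_image_sub _ _ (fun=> 0) _ _ (SNR alpha) (@subset_refl _ _).
  by apply; exists (k * SNR alpha t).
apply/odds_scaleP => //.
by apply: (@pinvK _ _ _ (SNR_dom I alpha) (SNR alpha)); rewrite inE.
Qed.

Lemma level_rateE {R : realType} {I : set R} {alpha : R -> R}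
    (halpha : noise_schedule I alpha) (m : nat) {t : R} :
  I° t -> 0 < alpha t < 1 ->
  level_rate I alpha m t =
  derive1 (odds_scale (2 ^+ (2 * m))) (alpha t) * derive1 alpha t.
Proof.
move=> It at01; have dalpha := schedule_derivable halpha It.
have k1 : (1 : R) <= 2 ^+ (2 * m) by apply: exprn_ege1; lra.
rewrite -derive1_comp//; last exact: derivable_odds_scale.
rewrite /level_rate !derive1E; apply: near_eq_derive.
have ca : {for t, continuous alpha}.
  by apply: differentiable_continuous; apply/derivable1_diffP.
have /andP[at0 at1] := at01.
(* The closed form holds only on [SNR_dom], but this is a neighbourhood of [t]: [t] is interior and
   [alpha] is continuous there, so both strict bounds persist. *)
near=> u => /=; apply: alpha_adjusted_time => //; split.
  by near: u; exact: It.
apply/andP; split; near: u.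
  exact: (cvgr_gt _ ca).
exact: (cvgr_lt _ ca).
Unshelve. all: by end_near. Qed.

Lemma chromatographyE {R : realType} {I : set R} {alpha : R -> R}
    (halpha : noise_schedule I alpha) {M : nat} (m : 'I_M) {t : R} :
  chromatography_defined I alpha M t ->
  chromatography I alpha m t =
  (\sum_(n < M) derive1 (odds_scale (2 ^+ (2 * n))) (alpha t))^-1 *
  derive1 (odds_scale (2 ^+ (2 * m))) (alpha t).
Proof.
case=> It at01; rewrite /chromatography.
have -> : normalization I alpha M t =
    (\sum_(n < M) derive1 (odds_scale (2 ^+ (2 * n))) (alpha t)) *
    derive1 alpha t.
  by rewrite mulr_suml; apply: eq_bigr => n _; exact: level_rateE.
(* In factored form, a nonzero normalization makes both the sum and the derivative of [alpha]
   nonzero, so the latter cancels. *)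
rewrite (level_rateE halpha)// mulf_eq0 negb_or => /andP[s0 d0].
by field; rewrite s0.
Qed.

Theorem theorem1 (R : realType) (M : nat) (hM : (0 < M)%N)
    (I I' : set R) (alpha alpha' : R -> R)
    (halpha : noise_schedule I alpha) (halpha' : noise_schedule I' alpha')
    (t' : R -> R) (ht' : forall t : R, I t -> I' (t' t))
    (hmatch : forall t : R, I t -> alpha t = alpha' (t' t)) :
  forall (m : 'I_M) (t : R), I t -> 0 < alpha t < 1 ->
    chromatography_defined I alpha M t ->
    chromatography_defined I' alpha' M (t' t) ->
    chromatography I alpha m t = chromatography I' alpha' m (t' t).
Proof.
move=> m t It _ dt dt'.
by rewrite (chromatographyE halpha)// (chromatographyE halpha')// hmatch.
Qed.
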